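(* For all integers $r\geq 2$ and $t\geq \frac{r^2-r+2}{2}$, there exists an asymmetric digraph $D$ with $\operatorname{dc}(D)=r$ and $\operatorname{dac}(D)=t$.
   Context: Digraphs are finite, without loops and without parallel arcs; $V(D)$ and $A(D)$ denote the vertex set and the arc set of $D$. A digraph is asymmetric (an oriented graph) if it never contains both $(u,v)$ and $(v,u)$ as arcs. A coloring of $D$ with $k$ colors is a function $\varphi:V(D)\to[k]=\{1,\dots,k\}$ using all $k$ colors; its chromatic classes are $C_i=\{v\in V(D):\varphi(v)=i\}$. The coloring is acyclic if no chromatic class induces a subdigraph containing a directed cycle. It is complete if for every ordered pair $(i,j)$ of distinct colors there is at least one arc from a vertex of color $i$ to a vertex of color $j$. The dichromatic number $\operatorname{dc}(D)$ is the minimum number of colors in an acyclic coloring of $D$; the diachromatic number $\operatorname{dac}(D)$ is the maximum number of colors in a complete acyclic coloring of $D$. *)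

(* Defs.v *)
From mathcomp Require Import all_boot.

Set Implicit Arguments.
Unset Strict Implicit.
Unset Printing Implicit Defensive.

(* The arc set is a relation, so parallel arcs are excluded by construction. *)
Record digraph := Digraph {
  vertex :> finType;
  arc : rel vertex;
  arc_irr : irreflexive arc
}.

Definition asymmetric (D : digraph) : Prop :=
  forall u v : D, ~~ (arc u v && arc v u).

(* The subdigraph induced by A contains a directed cycle. A vertex sequence c
   is a directed cycle when its vertices are pairwise distinct and each one has
   an arc to its cyclic successor; [cycle] accepts the empty sequence, which is
   therefore ruled out, and one-vertex cycles are impossible by [arc_irr]. *)
Definition induces_dicycle (D : digraph) (A : {set D}) : Prop :=
  exists c : seq D, [/\ c != [::], {subset c <= A} & ucycle (@arc D) c].

(* The k colors are 0, ..., k - 1, and all of them are used. *)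
Definition coloring (D : digraph) (k : nat) (phi : D -> 'I_k) : Prop :=
  forall i : 'I_k, exists v : D, phi v = i.

Definition chromatic_class (D : digraph) (k : nat) (phi : D -> 'I_k)
    (i : 'I_k) : {set D} :=
  [set v | phi v == i].

Definition acyclic_coloring (D : digraph) (k : nat) (phi : D -> 'I_k) : Prop :=
  coloring phi /\ forall i : 'I_k, ~ induces_dicycle (chromatic_class phi i).

Definition complete_coloring (D : digraph) (k : nat) (phi : D -> 'I_k) : Prop :=
  coloring phi /\
  forall i j : 'I_k, i != j ->
    exists u v : D, [/\ phi u = i, phi v = j & arc u v].

Definition is_min (P : nat -> Prop) (m : nat) : Prop :=
  P m /\ forall k, P k -> m <= k.

Definition is_max (P : nat -> Prop) (m : nat) : Prop :=
  P m /\ forall k, P k -> k <= m.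

Definition is_dichromatic_number (D : digraph) (r : nat) : Prop :=
  is_min (fun k => exists phi : D -> 'I_k, acyclic_coloring phi) r.

Definition is_diachromatic_number (D : digraph) (t : nat) : Prop :=
  is_max (fun k => exists phi : D -> 'I_k,
                     acyclic_coloring phi /\ complete_coloring phi) t.

(* Main.v *)
From mathcomp Require Import all_boot ssralg zmodp zify.
From Stdlib Require Import Classical.
Require Import Defs.
Import GRing.Theory.

Set Implicit Arguments.
Unset Strict Implicit.
Unset Printing Implicit Defensive.

(** The digraphs have vertex set ['I_t * bool], read as [t] pairs, and between
    any two pairs there are arcs in both directions. The pairs are then the
    classes of a complete acyclic coloring with [t] colors. No complete coloring
    has more: in an asymmetric digraph at most one class is a singleton, so
    [k] classes need [2 k - 1] vertices. Hence the diachromatic number is [t]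
    for free ([paired_diachromatic]), and only the dichromatic number has to be
    tuned while the pairs stay completely joined.

    Tuning is a discrete continuity argument. Given such a digraph, let [pad]
    turn every pair from the [k]-th on into a source and a sink for all earlier
    pairs. For [k = 0] nothing is left but an acyclic digraph, and passing from
    [k] to [k + 1] changes arcs at one pair only, which can receive a new
    color; so the dichromatic number grows by steps of at most one. It therefore
    takes the value [r] as soon as some completely joined digraph on at most [t]
    pairs has dichromatic number at least [r] ([realize_from_core]).

    It remains to find, on at most [t0 = 'C(r, 2) + 1 = (r ^ 2 - r + 2) / 2]
    pairs, a completely joined digraph that is not [(r - 1)]-colorable. On [t0]
    pairs there are [2 t0 = r (r - 1) + 2] vertices, so it suffices that acyclic
    sets have at most [r] elements, even after one vertex has been discarded. In
    a tournament an acyclic set is a transitive chain, which can be counted or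
    searched for.

    - For [r >= 18] a counting argument works. Choose for any two pairs, by one
      bit, one of the two orientations of the 4-cycle through them; the pairs
      are completely joined whatever the bits. A prescribed chain of [r]
      vertices from distinct pairs fixes ['C(r, 2)] bits, and there are at most
      [(2 t0) ^ r < 2 ^ 'C(r, 2)] chains, so some choice of the bits has none.
      An acyclic set contains at most one full pair, whence the bound [r].
    - For [r < 18] circulant tournaments on the integers modulo [p] are used, on
      the residues [0, 1, -1, 2, -2, ...] paired by negation. Negation reverses
      every arc, so these pairs are completely joined too. Suitable connection
      sets are unions of cosets of a multiplicative group (the squares, in most
      cases); this symmetry lets one assume that a chain starts with [0] and
      one of a few representatives, after which an exhaustive search is short. *)

(** * Acyclic sets *)

Lemma induces_dicycle_sub (D : digraph) (A B : {set D}) :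
  A \subset B -> induces_dicycle A -> induces_dicycle B.
Proof.
move=> /subsetP AB [c [c0 cA cyc]]; exists c; split=> // x /cA; exact: AB.
Qed.

Lemma induces_dicycle_image (D D' : digraph) (f : D -> D') (A : {set D}) :
    {in A &, injective f} -> {in A &, {homo f : u v / arc u v}} ->
  induces_dicycle A -> induces_dicycle (f @: A).
Proof.
move=> finj farc [c [c0 cA /andP[cyc unc]]]; exists (map f c); split.
- by case: c c0 {cA cyc unc}.
- by move=> _ /mapP[x /cA xA ->]; exact: imset_f.
apply/andP; split; last first.
  by rewrite map_inj_in_uniq // => x y /cA xA /cA yA; exact: finj.
by apply: homo_cycle_in farc _ cyc; apply/allP => x /cA.
Qed.

Lemma acyclic_rank (D : digraph) (f : D -> nat) (A : {set D}) :
  (forall u v : D, arc u v -> f u < f v) -> ~ induces_dicycle A.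
Proof.
move=> farc [[|x p] [] // _ _ /andP[cyc _]].
have tr : transitive (relpre f ltn) by move=> y x' z; exact: ltn_trans.
have /(order_path_min tr)/allP/(_ x) : path (relpre f ltn) x (rcons p x).
  by apply: sub_path cyc => u v; exact: farc.
by rewrite mem_rcons inE eqxx /= ltnn => /(_ isT).
Qed.

Lemma dicycle_card_gt2 (D : digraph) (A : {set D}) :
  asymmetric D -> induces_dicycle A -> 2 < #|A|.
Proof.
move=> asym [c [c0 cA /andP[cyc unc]]].
have: 2 < size c.
  case: c c0 cA cyc unc => [//|x [|y [|//]]] _ _ /=.
    by rewrite arc_irr.
  by rewrite andbT => xyx; move: (asym x y); rewrite xyx.
move=> /leq_trans; apply; rewrite cardE; apply: uniq_leq_size => // x /cA.
by rewrite mem_enum.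
Qed.

(** Without a source, following in-neighbors inside [A] eventually loops, and
    the loop read backwards is a directed cycle. *)
Lemma acyclic_source (D : digraph) (A : {set D}) :
    A != set0 -> ~ induces_dicycle A ->
  exists2 v, v \in A & {in A, forall w, ~~ arc w v}.
Proof.
move=> /set0Pn[x xA] acyc.
pose source v := (v \in A) && [forall w in A, ~~ arc w v].
case: (pickP source) => [v /andP[vA /forall_inP vs]|nosource].
  by exists v.
case: acyc.
pose f v := odflt x [pick w in A | arc w v].
have fP v : v \in A -> (f v \in A) && arc (f v) v.
  move=> vA; rewrite /f; case: pickP => [w //|none].
  move: (nosource v); rewrite /source vA /= => /negbT/forall_inPn[w wA].
  by rewrite negbK => wv; move: (none w); rewrite wA wv.
have fA n : iter n f x \in A by elim: n => //= n /fP/andP[].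
have : looping f x (order f x) by exact: looping_order.
rewrite /looping => /trajectP[i ltio eq_i].
pose y := iter i f x.
have yper : iter (order f x - i) f y = y.
  by rewrite /y -iterD subnK ?eq_i // ltnW.
have cyc : fcycle f (orbit f y).
  apply/(orbitPcycle 0 3); exists (order f x - i).-1.
  by rewrite prednK ?subn_gt0.
have oA : {subset orbit f y <= A}.
  by move=> z; rewrite -fconnect_orbit => /iter_findex <-; rewrite /y -iterD.
exists (rev (orbit f y)); split=> [|z|].
- by rewrite -size_eq0 size_rev size_orbit -lt0n order_gt0.
- by rewrite mem_rev => /oA.
rewrite /ucycle rev_uniq orbit_uniq andbT rev_cycle.
apply: sub_in_cycle (_ : {in A &, subrel (frel f) _}) _ _ cyc; last exact/allP.
by move=> u v uA _ /eqP <-; case/andP: (fP u uA).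
Qed.

(** Removing sources one after the other sorts an acyclic set topologically; when
    any two vertices are adjacent, the sorted list is a transitive chain. All
    bounds on acyclic sets below are obtained from bounds on such lists, which
    are transported by [map] much more easily than sets without cycles. *)
Lemma acyclic_pairwise (D : digraph) (A : {set D}) :
    {in A &, forall u v, u != v -> arc u v || arc v u} ->
    ~ induces_dicycle A ->
  exists2 s : seq D, s =i A & pairwise (@arc D) s.
Proof.
have [n] := ubnP #|A|; elim: n => // n IHn in A * => /ltnSE leAn tourA acyc.
have [->|A0] := eqVneq A set0; first by exists [::] => // x; rewrite !inE.
have [v vA vsource] := acyclic_source A0 acyc.
have subA : A :\ v \subset A by exact: subD1set.
have [|||s sA s_pw] := IHn (A :\ v).
- by apply: leq_trans leAn; rewrite [#|A|](cardsD1 v) vA.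
- by move=> u w /(subsetP subA) uA /(subsetP subA); exact: tourA.
- by move/(induces_dicycle_sub subA).
exists (v :: s) => [x|/=].
  by rewrite inE sA !inE; case: eqVneq => // ->; rewrite vA.
rewrite s_pw andbT; apply/allP => w; rewrite sA !inE => /andP[wv wA].
by have := tourA _ _ wA vA wv; rewrite (negPf (vsource w wA)).
Qed.

(** * Colorability *)

(** Unlike [acyclic_coloring], this does not ask for all colors to be used, which
    makes it monotone in the number of colors; natural numbers as colors allow
    a color to be added or skipped without casts. *)
Definition colorable (D : digraph) (c : nat) : Prop :=
  exists h : D -> nat,
    (forall v, h v < c) /\ forall n, ~ induces_dicycle [set v | h v == n].

Lemma colorableW (D : digraph) (c c' : nat) :
  c <= c' -> colorable D c -> colorable D c'.
Proof.
by move=> le_c [h [hc hA]]; exists h; split=> // v; exact: leq_trans le_c.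
Qed.

Lemma acyclic_coloring_colorable (D : digraph) (c : nat) (phi : D -> 'I_c) :
  acyclic_coloring phi -> colorable D c.
Proof.
move=> [_ phiA]; exists (fun v => val (phi v)); split=> [v|n]; first exact: ltn_ord.
have [nc|cn] := ltnP n c; first exact: (phiA (Ordinal nc)).
suff ->: [set v | val (phi v) == n] = set0.
  by case=> -[|x c'] [] // _ /(_ x (mem_head _ _)); rewrite inE.
apply/setP => v; rewrite !inE; apply/negP => /eqP vn.
by move: cn; rewrite -vn leqNgt ltn_ord.
Qed.

Lemma colorable_embed (D D' : digraph) (f : D -> D') (c : nat) :
    injective f -> {homo f : u v / arc u v} ->
  colorable D' c -> colorable D c.
Proof.
move=> finj farc [h [hc hA]]; exists (h \o f); split=> [v|n dic]; first exact: hc.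
apply: (hA n); apply: (@induces_dicycle_sub _ (f @: [set v | h (f v) == n])).
  by apply/subsetP => _ /imsetP[x + ->]; rewrite !inE.
apply: induces_dicycle_image dic; first exact: in2W.
exact: in2W.
Qed.

(** With [r + 1] colors all of them must appear: an unused color could be
    skipped by [unbump], leaving a coloring with [r] colors. *)
Lemma is_dichromatic_numberI (D : digraph) (r : nat) :
  colorable D r.+1 -> ~ colorable D r -> is_dichromatic_number D r.+1.
Proof.
move=> [h [hr hA]] ncol; split; last first.
  move=> k [phi /acyclic_coloring_colorable Dk].
  by rewrite ltnNge; apply/negP => /colorableW/(_ Dk).
exists (fun v => Ordinal (hr v)); split=> [i|i]; last exact: hA.
apply: NNPP => missing; apply: ncol.
have hi v : h v != i.
  by apply/eqP => vi; apply: missing; exists v; exact: val_inj.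
exists (unbump i \o h); split=> [v|n].
  have lth := hr v; have lti := ltn_ord i; rewrite /= /unbump.
  have [ih|hi' |/eqP] := ltngtP i (h v); last by rewrite eq_sym (negPf (hi v)).
    by rewrite subn1 -ltnS prednK ?(leq_ltn_trans _ ih).
  by rewrite subn0 (leq_trans hi').
suff ->: [set v | (unbump i \o h) v == n] = [set v | h v == bump i n].
  exact: hA.
apply/setP => v; rewrite !inE /=.
by apply/eqP/eqP => [<-|->]; rewrite ?bumpK // unbumpK ?inE.
Qed.

Lemma uncolorable_of_acyclic_bound (D : digraph) (S : {set D}) (a c : nat) :
    (forall A : {set D}, A \subset S -> ~ induces_dicycle A -> #|A| <= a) ->
    c * a < #|S| ->
  ~ colorable D c.
Proof.
move=> bound; rewrite ltnNge => /negP ltS [h [hc hA]]; apply: ltS.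
rewrite -sum1_card (partition_big (fun v => Ordinal (hc v)) predT) //=.
rewrite -[leqRHS](_ : \sum_(i < c) a = _); last by rewrite sum_nat_const card_ord.
apply: leq_sum => i _.
rewrite (eq_bigl [in S :&: [set v | h v == i]]) => [|v]; last first.
  by rewrite !inE.
rewrite sum1_card; apply: bound; first exact: subsetIl.
by move/(induces_dicycle_sub (subsetIr _ _)); exact: hA.
Qed.

(** * Completely joined pairs *)

Definition strict_arc (T : Type) (e : rel T) : rel T :=
  [rel u v | e u v && ~~ e v u].

Lemma strict_arc_irr (T : Type) (e : rel T) : irreflexive (strict_arc e).
Proof. by move=> u; rewrite /strict_arc /= andbN. Qed.

(** Keeping only the arcs that are not reversed makes any relation into an
    asymmetric digraph, with no side condition to carry around. *)
Definition oriented (T : finType) (e : rel T) : digraph :=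
  Digraph (@strict_arc_irr T e).

Lemma oriented_asymmetric (T : finType) (e : rel T) : asymmetric (oriented e).
Proof. by move=> u v; rewrite /= /strict_arc /=; case: (e u v) (e v u) => [] []. Qed.

(** The relation lives on [nat * bool] so that the same [e] can be restricted to
    any number [t] of pairs. *)
Definition paired (e : rel (nat * bool)) (t : nat) : digraph :=
  oriented (relpre (fun u : 'I_t * bool => (val u.1, u.2)) e).

Definition complete_pairing (e : rel (nat * bool)) (t : nat) : Prop :=
  forall i j, i < t -> j < t -> i != j ->
    exists x y, strict_arc e (i, x) (j, y).

(** Two singleton classes would need arcs in both directions between their
    vertices. *)
Lemma complete_coloring_bound (D : digraph) (k : nat) (phi : D -> 'I_k) :
  asymmetric D -> complete_coloring phi -> k.*2 <= #|D|.+1.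
Proof.
move=> asym [surj compl].
have cls_gt0 i : 0 < #|[set v | phi v == i]|.
  by have [v vi] := surj i; apply/card_gt0P; exists v; rewrite inE vi.
have one_singleton i j : i != j -> #|[set v | phi v == i]| <= 1 ->
    1 < #|[set v | phi v == j]|.
  move=> ij /card_le1P i1; rewrite ltnNge; apply/negP => /card_le1P j1.
  have [u [v [ui vj uv]]] := compl i j ij.
  have [v' [u' [vj' ui' vu]]] : exists u v, [/\ phi u = j, phi v = i & arc u v].
    by apply: compl; rewrite eq_sym.
  have: u' \in pred1 u by rewrite -i1 ?inE ?ui ?ui'.
  have: v' \in pred1 v by rewrite -j1 ?inE ?vj ?vj'.
  rewrite !inE => /eqP v'v /eqP u'u; subst.
  by move: (asym u v); rewrite uv vu.
have ->: #|D| = \sum_(i < k) #|[set v | phi v == i]|.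
  rewrite -sum1_card (partition_big phi predT) //=; apply: eq_bigr => i _.
  by rewrite -sum1_card; apply: eq_bigl => v; rewrite inE.
have ->: k.*2 = \sum_(i < k) 2 by rewrite sum_nat_const card_ord muln2.
case: (pickP (fun i => #|[set v | phi v == i]| <= 1)) => [i i1|big].
  rewrite (bigD1 i) //= [in leqRHS](bigD1 i) //= -addSn leq_add ?ltnS //.
  by apply: leq_sum => j ji; rewrite (one_singleton i) // eq_sym.
by rewrite leqW //; apply: leq_sum => j _; rewrite ltnNge big.
Qed.

Lemma paired_diachromatic (e : rel (nat * bool)) (t : nat) :
  complete_pairing e t -> is_diachromatic_number (paired e t) t.
Proof.
move=> compl; have asym : asymmetric (paired e t) by exact: oriented_asymmetric.
have surj : coloring (fst : paired e t -> 'I_t) by move=> i; exists (i, true).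
split; last first.
  move=> k [phi [_ /(complete_coloring_bound asym)]].
  by rewrite card_prod card_ord card_bool muln2 leq_Sdouble.
exists fst; split; split=> // i; last move=> j ij.
  move/(dicycle_card_gt2 asym); rewrite ltnNge => /negP; apply.
  apply: (@leq_trans #|[set (i, false); (i, true)]|); last by rewrite cards2 ltnS leq_b1.
  apply: subset_leq_card; apply/subsetP => -[j x]; rewrite !inE /= => /eqP ->.
  by case: x; rewrite eqxx ?orbT.
have [x [y xy]] := compl i j (ltn_ord i) (ltn_ord j) ij.
by exists (i, x), (j, y).
Qed.

(** * Reaching the exact dichromatic number *)

(** From the [k]-th pair on, [(j, false)] is a source and [(j, true)] a sink
    relative to all earlier pairs. *)
Definition pad (e : rel (nat * bool)) (k : nat) : rel (nat * bool) :=
  fun u v => if (u.1 < k) && (v.1 < k) then e u v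
             else (u.1 < v.1) && v.2 || (v.1 < u.1) && ~~ u.2.

Lemma pad_complete (e : rel (nat * bool)) (k t : nat) :
  complete_pairing e k -> complete_pairing (pad e k) t.
Proof.
move=> compl i j _ _ ij; rewrite /strict_arc /pad /=.
have [/andP[ik jk]|/negPf nk] := boolP ((i < k) && (j < k)).
  by have [x [y xy]] := compl i j ik jk ij; exists x, y; rewrite ik jk.
by exists false, true; rewrite [(j < k) && _]andbC nk !andbT !andbF orbF -neq_ltn ij.
Qed.

(** The two relations differ only at the [k]-th pair, which receives the new
    color; two vertices cannot carry a directed cycle. *)
Lemma pad_step (e : rel (nat * bool)) (k t c : nat) :
  colorable (paired (pad e k) t) c -> colorable (paired (pad e k.+1) t) c.+1.
Proof.
move=> [h [hc hA]]; pose g (u : 'I_t * bool) := if val u.1 == k then c else h u.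
have asym : asymmetric (paired (pad e k.+1) t) by exact: oriented_asymmetric.
exists g; split=> [u|n].
  by rewrite /g; case: ifP => // _; exact: leqW.
have [->|nc] := eqVneq n c.
  move/(dicycle_card_gt2 asym); rewrite ltnNge => /negP; apply.
  have gE (u : 'I_t * bool) : g u == c -> val u.1 = k.
    rewrite /g; have [->|_ /eqP hu] := eqVneq (val u.1) k; first by [].
    by have := hc u; rewrite hu ltnn.
  rewrite -card_bool -(card_in_imset (f := snd) (D := mem [set u | g u == c])).
    exact: max_card.
  move=> [i x] [j y]; rewrite !inE => /gE /= ik /gE /= jk xy.
  by congr (_, _) => //; apply: val_inj; rewrite /= ik jk.
move=> dic; apply: (hA n).
pose A : {set paired (pad e k.+1) t} := [set u | g u == n].
have gA u : u \in A -> val u.1 != k /\ h u = n.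
  rewrite inE /g; have [_ /eqP cn|_ /eqP] := eqVneq (val u.1) k; last by [].
  by rewrite cn eqxx in nc.
pose f : paired (pad e k.+1) t -> paired (pad e k) t := id.
apply: (@induces_dicycle_sub _ (f @: A)).
  by apply/subsetP => _ /imsetP[u /gA[_ un] ->]; rewrite inE un.
apply: induces_dicycle_image dic => // u v.
move=> /gA[uk _] /gA[vk _]; rewrite /= /strict_arc /= /pad /= !ltnS.
by rewrite ![val _ <= k]leq_eqVlt (negPf uk) (negPf vk).
Qed.

(** The arcs point away from the [false] vertices of large index, towards the
    [true] vertices of large index: the rank [t - i] or [t + i] increases. *)
Lemma pad0_colorable (e : rel (nat * bool)) (t : nat) :
  colorable (paired (pad e 0) t) 1.
Proof.
exists (fun=> 0); split=> // n.
pose f : paired (pad e 0) t -> nat := fun u => if u.2 then t + u.1 else t - u.1.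
apply: (@acyclic_rank _ f).
move=> [i x] [j y]; rewrite /f /= /strict_arc /= /pad /= => /andP[+ _].
have := ltn_ord i; have := ltn_ord j; case: x; case: y => /=; lia.
Qed.

(** Discrete continuity: at the first [k] where [r + 1] colors no longer suffice,
    [r + 2] colors do by [pad_step]. *)
Lemma exact_dichromatic (e : rel (nat * bool)) (t0 t r : nat) :
    ~ colorable (paired (pad e t0) t) r.+1 ->
  exists k, k <= t0 /\ is_dichromatic_number (paired (pad e k) t) r.+2.
Proof.
elim: t0 => [|k IHk] ncol.
  by case: ncol; apply: colorableW (pad0_colorable e t).
have [col|/IHk[k' [k'k dc]]] := classic (colorable (paired (pad e k) t) r.+1).
  by exists k.+1; split=> //; apply: is_dichromatic_numberI => //; exact: pad_step.
by exists k'; split=> //; exact: leqW.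
Qed.

Lemma realize_from_core (e : rel (nat * bool)) (t0 t r : nat) :
    complete_pairing e t0 -> t0 <= t -> ~ colorable (paired e t0) r.+1 ->
  exists D : digraph, [/\ asymmetric D, is_dichromatic_number D r.+2
                        & is_diachromatic_number D t].
Proof.
move=> compl le_t ncol.
have [k [kt0 dc]] : exists k, k <= t0 /\ is_dichromatic_number (paired (pad e k) t) r.+2.
  apply: exact_dichromatic => col; apply: ncol.
  pose f (u : 'I_t0 * bool) := (widen_ord le_t u.1, u.2).
  apply: (@colorable_embed (paired e t0) (paired (pad e t0) t) f) col.
    by move=> [i x] [j y] [ij ->]; congr (_, _); exact: val_inj.
  by move=> [i x] [j y]; rewrite /= /strict_arc /= /pad /= !ltn_ord.
exists (paired (pad e k) t); split=> //; first exact: oriented_asymmetric.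
apply: paired_diachromatic; apply: pad_complete => i j ik jk.
by apply: compl; apply: leq_trans kt0.
Qed.

(** * Searching for transitive chains *)

(** An exhaustive search showing that no list of elements of [C] which is
    pairwise related by [e] is longer than [k]: the head [v] of such a list
    confines the rest to [filter (e v) C]. The test on the size prunes the
    branches too small to matter. The partial application [e v] is shared by
    the whole filter, which is what makes the evaluation fast below. *)
Fixpoint chains_le (T : Type) (e : rel T) (k : nat) (C : seq T) : bool :=
  if k is k'.+1 then
    (size C <= k) || all (fun v => chains_le e k' (filter (e v) C)) C
  else nilp C.

Lemma chains_leP (T : eqType) (e : rel T) (k : nat) (C s : seq T) :
    irreflexive e -> chains_le e k C -> {subset s <= C} ->
  pairwise e s -> size s <= k.
Proof.
move=> irr; elim: k C s => [|k IHk] C s /=.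
  by case: C => // _; case: s => // x s /(_ x (mem_head _ _)).
move=> /orP[leC|/allP searchC] sC s_pw.
  by apply: leq_trans leC; apply: uniq_leq_size sC; exact: pairwise_uniq s_pw.
case: s sC s_pw => // v s sC /= /andP[/allP sv s_pw].
apply: IHk (searchC v _) _ s_pw; first by apply: sC; exact: mem_head.
by move=> w ws; rewrite mem_filter sv // sC // inE ws orbT.
Qed.

Lemma chains_le_map (T T' : Type) (f : T -> T') (e : rel T') (k : nat) (C : seq T) :
  chains_le e k (map f C) = chains_le (relpre f e) k C.
Proof.
elim: k C => [|k IHk] C /=; first by case: C.
by rewrite size_map all_map; congr orb; apply: eq_all => v /=; rewrite filter_map IHk.
Qed.

Lemma eq_in_chains_le (T : eqType) (e e' : rel T) (k : nat) (C : seq T) :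
  {in C &, e =2 e'} -> chains_le e k C = chains_le e' k C.
Proof.
elim: k C => //= k IHk C eq_e; congr orb; apply: eq_in_all => v vC.
have -> : filter (e' v) C = filter (e v) C.
  by apply: eq_in_filter => w wC; rewrite eq_e.
by apply: IHk => u w; rewrite !mem_filter => /andP[_ uC] /andP[_ wC]; exact: eq_e.
Qed.

(** * Circulant tournaments *)

Section Circulant.

Variables (q g n : nat) (R : seq nat).

Definition mulg_mod (x : nat) : nat := (g * x) %% q.+2.

(** The orbits of the representatives [R] under multiplication by [g]. *)
Definition connection_seq : seq nat :=
  flatten [seq traject mulg_mod rho n | rho <- R].

Definition connection : {pred 'I_q.+2} := fun x => val x \in connection_seq.

Definition circulant : rel 'I_q.+2 := fun u v => (v - u)%R \in connection.

Definition circulant_table : seq bool :=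
  [seq (x %% q.+2) \in connection_seq | x <- iota 0 (q.+2).*2].

(** A residue is looked up in a table covering two periods, so that
    [q.+2 - v + w] needs no reduction. The test says that the connection set
    contains exactly one of [x] and [- x] for [x != 0], but not [0], that [n] steps bring each
    representative back to itself, and that a chain beginning with [0] and a
    representative has at most [a] further elements. *)
Definition circulant_check (a : nat) : bool :=
  let tab := circulant_table in
  let e := fun v => nth false (drop (q.+2 - v) tab) in
  [&& ~~ nth false tab 0,
      all (fun x => nth false tab x != nth false tab (q.+2 - x)) (iota 1 q.+1)
    & all (fun rho => [&& rho < q.+2, iter n mulg_mod rho == rho
             & chains_le e a
                 [seq w <- iota 0 q.+2 | e 0 w && e rho w]]) R].

Local Open Scope ring_scope.

Lemma connection_table (x : nat) : (x < (q.+2).*2)%N ->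
  nth false circulant_table x = (inZp x \in connection).
Proof. by move=> ltx; rewrite (nth_map 0%N) ?size_iota // nth_iota. Qed.

Lemma val_expgM (k : nat) (x : 'I_q.+2) :
  val (inZp g ^+ k * x) = iter k mulg_mod (val x).
Proof.
elim: k => [|k IHk]; first by rewrite expr0 mul1r.
by rewrite exprS -mulrA iterS -IHk /mulg_mod /= modnMml.
Qed.

Lemma circulant_tableE (u w : nat) : (u < q.+2)%N -> (w < q.+2)%N ->
  nth false (drop (q.+2 - u) circulant_table) w = circulant (inZp u) (inZp w).
Proof.
move=> ltu ltw; rewrite nth_drop connection_table; last first.
  by rewrite -addnn -addnS leq_add // leq_subr.
congr (_ \in connection); apply: val_inj => /=.
by rewrite (modn_small ltu) modnDm addnC.
Qed.

Hypothesis n_gt0 : (0 < n)%N.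
Variable a : nat.
Hypothesis check : circulant_check a.

Lemma circulant_irr : irreflexive circulant.
Proof.
case/and3P: check => J0 _ _ u.
by rewrite /circulant subrr; apply: contraNF J0; rewrite connection_table.
Qed.

Lemma circulant_anti (u v : 'I_q.+2) : u != v -> circulant v u = ~~ circulant u v.
Proof.
case/and3P: check => _ /allP anti _ uv.
rewrite /circulant -[u - v]opprB; set x := v - u.
have x_gt0 : (0 < x)%N by rewrite lt0n; rewrite -subr_eq0 -opprB oppr_eq0 in uv.
have /anti : val x \in iota 1 q.+1 by rewrite mem_iota x_gt0 add1n; exact: ltn_ord.
have lt2 y : (y <= q.+2)%N -> (y < (q.+2).*2)%N.
  by move=> ley; rewrite -addnn -addn1 leq_add.
rewrite !connection_table ?lt2 ?leq_subr //; last exact: ltnW (ltn_ord x).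
have xE : inZp (val x) = x := valZpK x.
have xNE : inZp (q.+2 - val x) = - x by exact: val_inj.
rewrite xE xNE.
by case: (x \in _); case: (- x \in _).
Qed.

Lemma connectionM (x : 'I_q.+2) : x \in connection -> inZp g * x \in connection.
Proof.
case/and3P: check => _ _ /allP perR.
case/flatten_mapP=> rho rhoR /trajectP[i ltin xi].
have /and3P[_ /eqP per _] := perR _ rhoR.
apply/flatten_mapP; exists rho => //; apply/trajectP.
rewrite -[inZp g]expr1 val_expgM xi /=.
have [ltSn|] := ltnP i.+1 n; first by exists i.+1.
move=> len; exists 0%N => //=; have ni : n = i.+1 by apply/eqP; rewrite eqn_leq len.
by rewrite -[in RHS]per [in RHS]ni.
Qed.

(** The orbit of a representative is periodic, so going on around it from any of
    its elements leads back to the representative. *)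
Lemma connection_reach (x : 'I_q.+2) : x \in connection ->
  exists k rho, rho \in R /\ inZp g ^+ k * x = inZp rho.
Proof.
case/and3P: check => _ _ /allP perR.
case/flatten_mapP=> rho rhoR /trajectP[i ltin xi].
have /and3P[lt_rho /eqP per _] := perR _ rhoR.
exists (n - i)%N, rho; split => //; apply: val_inj.
by rewrite val_expgM xi -iterD subnK ?(ltnW ltin) //= per modn_small.
Qed.

Lemma connectionX (k : nat) (x : 'I_q.+2) :
  x \in connection -> inZp g ^+ k * x \in connection.
Proof.
move=> xJ; elim: k => [|k]; first by rewrite expr0 mul1r.
by rewrite exprS -mulrA; exact: connectionM.
Qed.

(** Translating by the first vertex of a chain and multiplying by a power of [g]
    are automorphisms; together they bring its first two vertices to [0] and a
    representative, where the search applies. *)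
Lemma circulant_chain_size (s : seq 'I_q.+2) : pairwise circulant s -> (size s <= a.+2)%N.
Proof.
case: s => [|v [|w s]] //=.
move=> /and3P[/andP[vw /allP sv] /allP sw s_pw].
have [k [rho [rhoR krho]]] := connection_reach vw.
pose f x := inZp g ^+ k * (x - v).
have f_homo : {homo f : x y / circulant x y}.
  move=> x y xy; rewrite /circulant /f -mulrBr; apply: connectionX.
  by rewrite opprB addrA subrK.
case/and3P: check => _ _ /allP/(_ _ rhoR)/and3P[lt_rho _ search].
rewrite !ltnS -(size_map f).
set C := (X in chains_le _ _ X) in search.
have ltC x : x \in C -> (x < q.+2)%N by rewrite mem_filter mem_iota => /andP[].
apply: (@chains_leP _ circulant a (map inZp C)); first exact: circulant_irr.
- rewrite chains_le_map; apply: etrans search; apply: eq_in_chains_le => x y xC yC.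
  by rewrite circulant_tableE ?ltC.
- move=> _ /mapP[x xs ->]; apply/mapP; exists (val (f x)); last first.
    by rewrite valZpK.
  rewrite mem_filter mem_iota ltn_ord andbT !circulant_tableE ?ltn_ord // valZpK -krho.
  have fv : f v = inZp 0 by rewrite /f subrr mulr0; apply: val_inj.
  by rewrite -fv !f_homo // ?sv ?sw.
- by rewrite pairwise_map; apply: sub_pairwise s_pw => x y; exact: f_homo.
Qed.

(** The pair [i] consists of [i] and [- i]. The pair [0] is degenerate: its two
    vertices are twins, and only one of them enters the lower bound on
    colorings. *)
Definition residue (u : nat * bool) : 'I_q.+2 :=
  if u.2 then inZp u.1 else - inZp u.1.

Definition reflected_circulant : rel (nat * bool) := relpre residue circulant.

Lemma circulant_strict (u v : 'I_q.+2) : strict_arc circulant u v = circulant u v.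
Proof.
have [->|uv] := eqVneq u v; first by rewrite /strict_arc /= circulant_irr.
by rewrite /strict_arc /= (circulant_anti uv) negbK andbb.
Qed.

Lemma inZp_inj (i j : nat) : (i < q.+2)%N -> (j < q.+2)%N ->
  inZp i = inZp j :> 'I_q.+2 -> i = j.
Proof. by move=> lti ltj /(congr1 val) /=; rewrite !modn_small. Qed.

(** Negation reverses arcs: if [j -> i] then [- i -> - j]. *)
Lemma reflected_complete (t : nat) :
  (t <= q.+2)%N -> complete_pairing reflected_circulant t.
Proof.
move=> let_q i j lti ltj ij.
have ij' : inZp i != inZp j :> 'I_q.+2.
  by apply: contra_neq ij; apply: inZp_inj; apply: leq_trans let_q.
have [c_ij|] := boolP (circulant (inZp i) (inZp j)).
  by exists true, true; rewrite -[strict_arc _ _ _]/(strict_arc circulant _ _) circulant_strict.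
rewrite -(circulant_anti ij') => c_ji; exists false, false.
rewrite -[strict_arc _ _ _]/(strict_arc circulant _ _) circulant_strict.
by rewrite /circulant /= opprK addrC.
Qed.

Lemma residue_inj (t : nat) : (t.*2 < q.+2)%N ->
  {in [set~ (ord0, false)] &,
    injective (fun u : 'I_t.+1 * bool => residue (val u.1, u.2))}.
Proof.
move=> lt_q.
have opp0 (i j : 'I_t.+1) : inZp i = - inZp j :> 'I_q.+2 -> val i = 0%N /\ val j = 0%N.
  move/eqP; rewrite -addr_eq0 => /eqP/(congr1 val) /=.
  have := ltn_ord i; have := ltn_ord j; rewrite modnDm => lej lei.
  by rewrite modn_small; lia.
move=> [i x] [j y]; rewrite !inE /residue /= => ix jy.
case: x y ix jy => [] [] ix jy /=.
- move/inZp_inj => ij; congr (_, _); apply/val_inj/ij.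
    by have := ltn_ord i; lia.
  by have := ltn_ord j; lia.
- by case/opp0 => _ j0; case/eqP: jy; congr (_, _); apply: val_inj.
- by move/esym/opp0 => [_ i0]; case/eqP: ix; congr (_, _); apply: val_inj.
move/oppr_inj/inZp_inj => ij; congr (_, _); apply/val_inj/ij.
  by have := ltn_ord i; lia.
by have := ltn_ord j; lia.
Qed.

Lemma reflected_uncolorable (t c : nat) :
    (t.*2 < q.+2)%N -> (c * a.+2 <= t.*2)%N ->
  ~ colorable (paired reflected_circulant t.+1) c.
Proof.
move=> lt_q lec.
apply: (@uncolorable_of_acyclic_bound (paired reflected_circulant t.+1)
          [set~ (ord0, false)] a.+2) => [A /subsetP AS acyc|].
  pose f (u : 'I_t.+1 * bool) := residue (val u.1, u.2).
  have arcE (u v : paired reflected_circulant t.+1) : arc u v = circulant (f u) (f v).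
    exact: circulant_strict.
  have [|s sA s_pw] := acyclic_pairwise _ acyc.
    move=> u v uA vA uv; rewrite !arcE -(negbK (circulant _ _)) -circulant_anti ?orNb //.
    by apply: contra_neq uv; apply: residue_inj; rewrite ?AS.
  rewrite -(eq_card sA).
  rewrite (leq_trans (card_size s)) // -(size_map f).
  apply: circulant_chain_size; rewrite pairwise_map.
  by apply: sub_pairwise s_pw => u v; rewrite arcE.
by rewrite cardsC1 card_prod card_ord card_bool muln2 ltnS.
Qed.

End Circulant.

(** * Doubled tournaments and counting *)

Section Doubling.

Variable t : nat.

(** Membership of [{i, j}] in [B] is the bit that chooses an orientation of the
    4-cycle through the pairs [i] and [j]; changing the second component of one
    endpoint reverses an arc, and the comparison of the indices makes the relation
    antisymmetric. Indexing the bits by all sets rather than by 2-element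
    sets multiplies all counts by the same constant. *)
Definition doubled (B : {set {set 'I_t.+1}}) : rel (nat * bool) :=
  fun u v => (u.1 != v.1) &&
    (([set inord u.1; inord v.1] \in B) (+) (u.1 < v.1) (+) (u.2 (+) v.2)).

Definition doubled_arc (B : {set {set 'I_t.+1}}) : rel ('I_t.+1 * bool) :=
  relpre (fun u => (val u.1, u.2)) (doubled B).

Lemma doubled_arcE (B : {set {set 'I_t.+1}}) (u v : 'I_t.+1 * bool) :
  doubled_arc B u v = (u.1 != v.1) &&
    (([set u.1; v.1] \in B) (+) (u.1 < v.1) (+) (u.2 (+) v.2)).
Proof. by rewrite /doubled_arc /doubled /= !inord_val. Qed.

Lemma doubled_anti (B : {set {set 'I_t.+1}}) (u v : 'I_t.+1 * bool) :
  u.1 != v.1 -> doubled_arc B v u = ~~ doubled_arc B u v.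
Proof.
move=> uv; rewrite !doubled_arcE uv eq_sym uv /= setUC [v.2 (+) _]addbC -addNb -addbN.
have: val u.1 != val v.1 by [].
by case: ltngtP.
Qed.

Lemma paired_doubledE (B : {set {set 'I_t.+1}}) (u v : paired (doubled B) t.+1) :
  arc u v = doubled_arc B u v.
Proof.
rewrite -[arc u v]/(doubled_arc B u v && ~~ doubled_arc B v u).
have [uv|uv] := eqVneq u.1 v.1; first by rewrite !doubled_arcE uv eqxx.
by rewrite (doubled_anti B uv) negbK andbb.
Qed.

Lemma doubled_complete (B : {set {set 'I_t.+1}}) :
  complete_pairing (doubled B) t.+1.
Proof.
move=> i j lti ltj ij; exists false.
exists (~~ (([set inord i; inord j] \in B) (+) (i < j))).
have arcE x y : strict_arc (doubled B) (i, x) (j, y) = doubled B (i, x) (j, y).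
  exact: (@paired_doubledE B (Ordinal lti, x) (Ordinal ltj, y)).
by rewrite arcE /doubled /= ij addbN addbb.
Qed.

Lemma pairwise_mem (T : eqType) (e : rel T) (s : seq T) (x y : T) :
  pairwise e s -> x \in s -> y \in s -> x != y -> e x y || e y x.
Proof.
elim: s => //= z s IHs /andP[/allP zs /IHs{}IHs]; rewrite !inE.
case/predU1P=> [->|xs] /predU1P[->|ys]; rewrite ?eqxx // => xy.
- by rewrite zs.
- by rewrite zs ?orbT.
exact: IHs.
Qed.

(** The arcs along a chain prescribe [B] on the set [K] of the 2-element subsets of
    its index set. Replacing that part of [B] by an arbitrary subset of [K] is
    therefore injective, and yields the factor [2 ^ #|K|]. *)
Lemma card_doubled_chain (s : seq ('I_t.+1 * bool)) : uniq (map fst s) ->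
  #|[set B | pairwise (doubled_arc B) s]| * 2 ^ 'C(size s, 2) <= #|{set {set 'I_t.+1}}|.
Proof.
move=> uniq_s; set bad := [set B | _].
pose K := [set P : {set 'I_t.+1} | P \subset [set i in map fst s] & #|P| == 2].
have badK B B' P : B \in bad -> B' \in bad -> P \in K -> (P \in B) = (P \in B').
  rewrite !inE => Bs B's /andP[/subsetP Ps /cards2P[i [j [ij Pij]]]].
  have /mapP[u us iu] : i \in map fst s.
    by have := Ps i; rewrite Pij !inE eqxx => /(_ isT).
  have /mapP[v vs jv] : j \in map fst s.
    by have := Ps j; rewrite Pij !inE eqxx orbT => /(_ isT).
  have uv1 : u.1 != v.1 by rewrite -iu -jv.
  have uv : u != v by apply: contraNneq uv1 => ->.
  have eq_uv : doubled_arc B u v = doubled_arc B' u v.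
    have := pairwise_relI (doubled_arc B) (doubled_arc B') s; rewrite Bs B's.
    case/pairwise_mem/(_ us vs uv)/orP => /andP[] /=; first by move=> -> ->.
    by rewrite !(doubled_anti _ uv1) => /negPf -> /negPf ->.
  by move: eq_uv; rewrite !doubled_arcE uv1 -iu -jv -Pij => /addIb/addIb.
have -> : 'C(size s, 2) = #|K|.
  by rewrite cards_draws cardsE; move/card_uniqP: uniq_s => ->; rewrite size_map.
rewrite -card_powerset -cardsX.
pose f (p : {set {set 'I_t.+1}} * {set {set 'I_t.+1}}) := (p.1 :\: K) :|: p.2.
rewrite -(card_in_imset (f := f)) ?max_card // => -[B X] [B' X'].
rewrite !in_setX /f /= !powersetE => /andP[badB XK] /andP[badB' X'K] /setP eqf.
have notX (Y : {set {set 'I_t.+1}}) P : Y \subset K -> P \notin K -> P \in Y = false.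
  by move=> /subsetP YK PK; apply: contraNF PK; exact: YK.
congr (_, _); apply/setP => P; have := eqf P; rewrite !in_setU !in_setD.
  have [PK _|PK] := boolP (P \in K); first exact: badK.
  by rewrite (notX X) // (notX X') // !orbF.
have [//|PK _] := boolP (P \in K); last by rewrite (notX X) // (notX X').
Qed.

(** Union bound over all [r]-tuples of vertices. *)
Lemma exists_doubled_no_chain (r : nat) : (t.+1 * 2) ^ r < 2 ^ 'C(r, 2) ->
  exists B, forall s : seq ('I_t.+1 * bool),
    size s = r -> uniq (map fst s) -> ~~ pairwise (doubled_arc B) s.
Proof.
move=> lt_r.
pose bad (s : r.-tuple ('I_t.+1 * bool)) :=
  if uniq (map fst s) then [set B | pairwise (doubled_arc B) s] else set0.
have bad_bound s : #|bad s| * 2 ^ 'C(r, 2) <= #|{set {set 'I_t.+1}}|.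
  rewrite /bad; case: ifP => [us|_]; last by rewrite cards0.
  by rewrite -[r in 'C(r, _)](size_tuple s) card_doubled_chain.
have [B nB|allbad] := pickP [pred B | [forall s, B \notin bad s]].
  exists B => s sr us; have := forallP nB (Tuple (introT eqP sr)).
  by rewrite /bad us inE.
move: bad_bound; rewrite -cardsT; set N := #|_| => bad_bound.
have N_gt0 : 0 < N by apply/card_gt0P; exists set0; rewrite in_setT.
have: N * (t.+1 * 2) ^ r < N * 2 ^ 'C(r, 2) by rewrite ltn_pmul2l.
rewrite ltnNge => /negP; case.
apply: (@leq_trans (\sum_s #|bad s| * 2 ^ 'C(r, 2))); last first.
  apply: leq_trans (leq_sum _ (fun s _ => bad_bound s)) _.
  by rewrite sum_nat_const card_tuple card_prod card_ord card_bool mulnC.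
rewrite -big_distrl leq_mul2r /=; apply/orP; right.
apply: (@leq_trans #|\bigcup_s bad s|).
  apply/subset_leq_card/subsetP => B _.
  have := allbad B; rewrite inE => /negbT/forallPn[s]; rewrite negbK => Bs.
  by apply/bigcupP; exists s.
elim/big_rec2: _ => [|s m U _ leU]; first by rewrite cards0.
by rewrite (leq_trans (leq_card_setU _ _)) // leq_add2l.
Qed.

(** Each change of second component reverses an arc, so the four arcs between two
    full pairs form a directed cycle, in one direction or the other. *)
Lemma four_cycle (B : {set {set 'I_t.+1}}) (A : {set paired (doubled B) t.+1})
    (i j : 'I_t.+1) (x y : bool) :
    i != j -> (i, x) \in A -> (i, ~~ x) \in A -> (j, y) \in A -> (j, ~~ y) \in A ->
  induces_dicycle A.
Proof.
move=> ij ix ix' jy jy'.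
have dic (s : seq ('I_t.+1 * bool)) :
    s != [::] -> {subset s <= A} -> uniq s -> cycle (doubled_arc B) s -> induces_dicycle A.
  move=> s0 sA us cyc; exists s; split=> //; rewrite /ucycle us andbT.
  by apply: sub_cycle cyc => u v; rewrite paired_doubledE.
pose a := doubled_arc B (i, x) (j, y).
have E x' y' : doubled_arc B (i, x') (j, y') = a (+) (x (+) x') (+) (y (+) y').
  rewrite /a !doubled_arcE /= ij /=.
  by case: (_ \in B) (i < j) (x) (x') (y) (y') => [] [] [] [] [] [].
have F x' y' : doubled_arc B (j, y') (i, x') = ~~ doubled_arc B (i, x') (j, y').
  exact: doubled_anti.
have [aT|/negPf aF] := boolP a.
  apply: (dic [:: (i, x); (j, y); (i, ~~ x); (j, ~~ y)]) => //.
  - by move=> u; rewrite !inE => /or4P[] /eqP ->.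
  - rewrite /= !inE !xpair_eqE !eqxx [j == i]eq_sym (negPf ij).
    by case: (x); case: (y).
  by rewrite [cycle _ _]/= !F !E aT; case: (x); case: (y).
apply: (dic [:: (j, ~~ y); (i, ~~ x); (j, y); (i, x)]) => //.
- by move=> u; rewrite !inE => /or4P[] /eqP ->.
- rewrite /= !inE !xpair_eqE !eqxx [j == i]eq_sym (negPf ij).
  by case: (x); case: (y).
by rewrite [cycle _ _]/= !F !E aF; case: (x); case: (y).
Qed.

(** By [four_cycle] an acyclic set contains at most one full pair. Dropping one of
    its vertices leaves at least [r] of [r + 1] vertices, now from distinct
    pairs, hence a chain of length [r]. *)
Lemma doubled_acyclic_card (B : {set {set 'I_t.+1}}) (r : nat)
    (A : {set paired (doubled B) t.+1}) :
    (forall s : seq ('I_t.+1 * bool),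
      size s = r -> uniq (map fst s) -> ~~ pairwise (doubled_arc B) s) ->
  ~ induces_dicycle A -> #|A| <= r.
Proof.
move=> nochain acyc; rewrite leqNgt; apply/negP => ltrA.
pose full i := ((i, true) \in A) && ((i, false) \in A).
have [A' [A'A leA inj]] : exists A' : {set paired (doubled B) t.+1},
    [/\ A' \subset A, #|A| <= #|A'|.+1 & {in A' &, forall u v, u.1 = v.1 -> u = v}].
  have [i /andP[i1 i0]|nofull] := pickP full.
    exists (A :\ (i, false)); split; first exact: subD1set.
      by rewrite [#|A|](cardsD1 (i, false)) i0.
    move=> [j x] [k y] /= + + jk; rewrite -{}jk {k} !inE !xpair_eqE => /andP[jx jxA] /andP[jy jyA].
    have [ji|ji] := eqVneq j i.
      by move: jx jy; rewrite ji eqxx; case: (x); case: (y).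
    have [->//|xy] := eqVneq x y; case: acyc.
    apply: (four_cycle (x := true) (y := x) _ i1 i0 jxA); first by rewrite eq_sym.
    by rewrite (_ : ~~ x = y) //; case: (x) (y) xy => [] [].
  exists A; split=> // -[j x] [k y] /= + + jk; rewrite -{}jk {k} => jx jy.
  have := nofull j; rewrite /full.
  by move: x y jx jy => [] [] jx jy //; rewrite ?jx ?jy.
have [|s sA' s_pw] := acyclic_pairwise _ (contra_not (induces_dicycle_sub A'A) acyc).
  move=> u v uA vA; rewrite !paired_doubledE => uv.
  by rewrite (doubled_anti B (u := u) (v := v)) ?orbN //; apply: contra_neq uv; exact: inj.
have le_rs : r <= size s.
  by rewrite -ltnS (leq_trans ltrA) // (leq_trans leA) // ltnS -(eq_card sA') card_size.
have uniq_s : uniq s by apply: pairwise_uniq s_pw; exact: arc_irr.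
have uniq_rs : uniq (map fst (take r s)).
  rewrite map_inj_in_uniq ?take_uniq // => u v /mem_take us /mem_take vs.
  by apply: inj; rewrite -sA'.
have /negP[] := nochain _ (size_takel le_rs) uniq_rs.
apply: (subseq_pairwise (take_subseq _ _)).
by apply: sub_pairwise s_pw => u v; rewrite paired_doubledE.
Qed.

Lemma doubled_uncolorable (r c : nat) :
    (t.+1 * 2) ^ r < 2 ^ 'C(r, 2) -> c * r < t.+1 * 2 ->
  exists B, ~ colorable (paired (doubled B) t.+1) c.
Proof.
move=> /exists_doubled_no_chain[B nochain] lt_c; exists B.
apply: (@uncolorable_of_acyclic_bound _ setT r) => [A _|].
  exact: doubled_acyclic_card.
by rewrite cardsT card_prod card_ord card_bool.
Qed.

End Doubling.

(** * Cores for all numbers of colors *)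

Lemma double_bin2 (r : nat) : 'C(r, 2).*2 = r * r.-1.
Proof.
rewrite bin2 -[RHS]odd_double_half oddM.
by case: r => //= r; rewrite andNb.
Qed.

(** The counting bound [(2 t0) ^ r < 2 ^ 'C(r, 2)], squared and with the exponent
    [r] removed; this is where [18] comes from. *)
Lemma square_lt_exp2 (r : nat) : 18 <= r -> ((r * r.-1).+2) ^ 2 < 2 ^ r.-1.
Proof.
elim: r => // r IHr; rewrite leq_eqVlt => /predU1P[<-|]; first exact: isT.
rewrite ltnS => le_r; have := IHr le_r.
case: r le_r {IHr} => // r le_r lt_r; rewrite [ltnRHS]expnS.
apply: (@leq_ltn_trans (2 * (r.+1 * r).+2 ^ 2)); last by rewrite ltn_pmul2l.
by rewrite -!mulnn; nia.
Qed.

(** The input of [realize_from_core]; the bound on [t] is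
    [(r ^ 2 - r + 2) / 2]. *)
Definition has_core (r : nat) : Prop :=
  exists t e, [/\ t <= 'C(r, 2).+1, complete_pairing e t
                & ~ colorable (paired e t) r.-1].

(** Only the [2 t + 1] residues of absolute value at most [t] are used: when chains
    are shorter than [r], fewer than the allowed number of pairs are enough, and
    one tournament serves a range of values of [r]. *)
Lemma circulant_core (q g n a t r : nat) (R : seq nat) :
    circulant_check q g n R a -> 0 < n -> t.*2 < q.+2 ->
    r.-1 * a.+2 <= t.*2 <= r * r.-1 ->
  has_core r.
Proof.
move=> check n_gt0 lt_q /andP[le_a le_r]; exists t.+1, (reflected_circulant q g n R); split.
- by rewrite ltnS -leq_double double_bin2.
- by apply: (reflected_complete check); apply: leq_ltn_trans lt_q; rewrite -addnn leq_addr.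
exact: (reflected_uncolorable n_gt0 check lt_q).
Qed.

Lemma counting_core (r : nat) : 18 <= r -> has_core r.
Proof.
move=> le_r.
have [||B ncol] := @doubled_uncolorable 'C(r, 2) r r.-1.
- rewrite -ltn_sqr -[ltnRHS]expnM [in ltnRHS]muln2 double_bin2 [in ltnRHS]mulnC [ltnRHS]expnM.
  rewrite [ltnLHS]expnAC ltn_exp2r; last by lia.
  by rewrite [ltnLHS](_ : _ = (r * r.-1).+2 ^ 2) ?square_lt_exp2 // muln2 doubleS double_bin2.
- by rewrite muln2 doubleS double_bin2 mulnC ltnS leqW.
exists 'C(r, 2).+1, (doubled B); split=> //; exact: doubled_complete.
Qed.

(** The certificates: [circulant_check q g n R a] bounds the chains in a
    tournament on [p = q + 2] residues by [a + 2]. The number [n] is the order of [g] modulo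
    [p]. For [R = [:: 1]] the connection set is the group of squares. Modulo [13]
    the squares are closed under negation, and modulo [31] they contain a chain
    of 7 elements, hence the unions of cosets of a group of order 3. *)
Lemma circulant_check3 : circulant_check 1 1 1 [:: 1] 0. Proof. by vm_compute. Qed.

Lemma circulant_check7 : circulant_check 5 2 3 [:: 1] 1. Proof. by vm_compute. Qed.

Lemma circulant_check13 : circulant_check 11 3 3 [:: 1; 2] 2. Proof. by vm_compute. Qed.

Lemma circulant_check23 : circulant_check 21 2 11 [:: 1] 3. Proof. by vm_compute. Qed.

Lemma circulant_check31 : circulant_check 29 5 3 [:: 1; 2; 3; 4; 8] 4.
Proof. by vm_compute. Qed.

Lemma circulant_check43 : circulant_check 41 9 21 [:: 1] 5. Proof. by vm_compute. Qed.

Lemma circulant_check83 : circulant_check 81 3 41 [:: 1] 6. Proof. by vm_compute. Qed.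

Lemma circulant_check199 : circulant_check 197 2 99 [:: 1] 10. Proof. by vm_compute. Qed.

Lemma small_core (r : nat) : 2 <= r < 18 -> has_core r.
Proof.
case/andP=> le2 lt18; have [le7|gt7] := leqP r 7.
  case: r le2 lt18 le7 => [|[|[|[|[|[|[|[|r]]]]]]]] // _ _ _.
  - exact: (circulant_core (t := 1) circulant_check3).
  - exact: (circulant_core (t := 3) circulant_check7).
  - exact: (circulant_core (t := 6) circulant_check13).
  - exact: (circulant_core (t := 10) circulant_check23).
  - exact: (circulant_core (t := 15) circulant_check31).
  - exact: (circulant_core (t := 21) circulant_check43).
have [le11|gt11] := leqP r 11.
  apply: (circulant_core (t := r.-1 * 4) circulant_check83) => //; rewrite -muln2; nia.
apply: (circulant_core (t := r.-1 * 6) circulant_check199) => //; rewrite -muln2; nia.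
Qed.

Theorem theorem13 (r t : nat) (hr : 2 <= r)
    (ht : (r ^ 2 - r + 2) %/ 2 <= t) :
  exists D : digraph,
    [/\ asymmetric D, is_dichromatic_number D r & is_diachromatic_number D t].
Proof.
have t0_le : 'C(r, 2).+1 <= t.
  apply: leq_trans ht; rewrite leq_divRL // muln2 doubleS double_bin2.
  by rewrite -mulnn -addn2 leq_add2r; case: r {hr} => //= r; nia.
have [t0 [e [le_t0 compl ncol]]] : has_core r.
  by have [/counting_core //|lt18] := leqP 18 r; apply: small_core; rewrite hr.
case: r hr ncol {ht le_t0 t0_le} (leq_trans le_t0 t0_le) => [|[|r]] // _ ncol t0_le.
exact: realize_from_core compl t0_le ncol.
Qed.
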